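(* For every $n \in \mathbb{N}$ (that is, $n \ge 1$), the maximum number of points in $\mathbb{R}_{\infty}^n$ with pairwise odd distances equals $2^n$.
   Context: $\mathbb{R}^n_{\infty}$ denotes $\mathbb{R}^n$ equipped with the maximum metric $\|\mathbf{x}-\mathbf{y}\|_{\infty} = \max_{1\le i\le n} |x_i-y_i|$. A set of points has pairwise odd distances if the distance between any two distinct points of the set is an odd integer. *)

(* Defs.v *)
From HB Require Import structures.
From mathcomp Require Import all_boot all_order all_algebra.
From mathcomp Require Import all_classical all_reals all_analysis.
Import Order.TTheory GRing.Theory Num.Theory.
Import numFieldNormedType.Exports.
Set Implicit Arguments.
Unset Strict Implicit.
Unset Printing Implicit Defensive.
Local Open Scope classical_set_scope.
Local Open Scope ring_scope.

Definition is_odd_integer (R : realType) (d : R) : Prop :=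
  exists k : int, d = (2 * k + 1)%:~R.

(* The norm on 'rV[R]_n is the maximum norm (mx_norm). *)
Definition pairwise_odd_distances (R : realType) (n : nat) (A : set 'rV[R]_n) : Prop :=
  forall x y, A x -> A y -> x <> y -> is_odd_integer `|x - y|.

(* #<= also compares infinite sets, so an infinite set satisfying P
   refutes maximality. *)
Definition is_maximum_cardinality (T : Type) (P : set T -> Prop) (m : nat) : Prop :=
  (exists A : set T, P A /\ (A #= `I_m)%card) /\
  (forall A : set T, P A -> (A #<= `I_m)%card).

(* Main.v *)
Require Import Defs.
From mathcomp Require Import all_boot all_order all_algebra.
From mathcomp Require Import all_classical all_reals all_analysis.
From mathcomp Require Import zify.
Import Order.TTheory GRing.Theory Num.Theory.
Import numFieldNormedType.Exports.
Local Open Scope classical_set_scope.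
Local Open Scope ring_scope.

(** If [`|x - y|] is an odd integer, then so is [x i - y i] for some coordinate
    [i], hence [floor (x i)] and [floor (y i)] have opposite parities. The
    parities of the [n] floors therefore separate the points of a set with
    pairwise odd distances, which embeds it into [bool ^ n]; the vertices of the
    unit cube attain the bound. *)

Lemma card_eq_finT (T : finType) : ([set: T] #= `I_#|T|)%card.
Proof.
have inj_rank : {in [set: T] &, injective (fun t => nat_of_ord (enum_rank t))}.
  by move=> s t _ _ /val_inj/enum_rank_inj.
have <- : [set nat_of_ord (enum_rank t) | t in [set: T]] = `I_#|T|.
  apply/seteqP; split=> [_ [t _ <-] //=|k /= ltk].
  by exists (enum_val (Ordinal ltk)); rewrite ?enum_valK.
by rewrite card_eq_sym; exact: inj_card_eq.
Qed.

Lemma odd_integer_neq0 (R : realType) (d : R) : is_odd_integer d -> d != 0.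
Proof. by case=> k ->; rewrite intr_eq0; lia. Qed.

(** Whatever the sign of [a - b], one of the two numbers is the other plus an odd integer. Since
    [Num.floor] commutes with adding an integer, the floors also differ by an odd integer. *)
Lemma even_floor_odd_distance (R : realType) (a b : R) :
  is_odd_integer `|a - b| ->
  (2 %| Num.floor a)%Z != (2 %| Num.floor b)%Z.
Proof.
suff aux (c d : R) (k : int) :
    c - d = (2 * k + 1)%:~R -> (2 %| Num.floor c)%Z != (2 %| Num.floor d)%Z.
  case=> k; case: (ger0P (a - b)) => _ ek; first exact: aux ek.
  by rewrite eq_sym; apply: (aux _ _ k); rewrite -opprB.
move=> /eqP; rewrite subr_eq => /eqP ->.
by rewrite floorDzr ?intr_int // intrKfloor; move: (Num.floor d) => m; lia.
Qed.

Lemma parity_separates (R : realType) (n : nat) (x y : 'rV[R]_n) :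
  is_odd_integer `|x - y| ->
  [ffun i => (2 %| Num.floor (x ord0 i))%Z] != 
    [ffun i => (2 %| Num.floor (y ord0 i))%Z].
Proof.
(* An odd norm is nonzero, so it is not the default value [0] of the maximum but the absolute value
   of some entry. *)
move=> oddxy; have [[i0 i] /= normE] := mx_norm_neq0 (odd_integer_neq0 _ _ oddxy).
move: oddxy; rewrite [`|x - y|]normE ord1 !mxE => /even_floor_odd_distance.
by apply: contra => /eqP/ffunP/(_ i); rewrite !ffunE => ->.
Qed.

(** Every entry of the difference is [-1], [0] or [1], and at least one is nonzero. *)
Lemma dist_cube_vertices (R : realType) (n : nat) (b c : {ffun 'I_n -> bool}) :
  b != c ->
  `|(\row_i (b i)%:R : 'rV[R]_n) - \row_i (c i)%:R| = 1.
Proof.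
move=> neqbc; set v := _ - _.
have v_neq0 : `|v| != 0.
  rewrite normr_eq0; apply: contra neqbc => /eqP/rowP v0.
  apply/eqP/ffunP => i; move: (v0 i); rewrite !mxE => /eqP.
  by rewrite subr_eq0 eqr_nat; case: (b i) (c i) => [] [].
have [[i0 i] /= normE] := mx_norm_neq0 v_neq0.
move: v_neq0; rewrite [`|v|]normE !mxE.
(* Equal bits at [i] would make the norm zero, against [v_neq0]; different bits give [1]. *)
by case: (b i) (c i) => [] [];
  rewrite ?subrr ?subr0 ?sub0r ?normrN ?normr0 ?normr1 ?eqxx.
Qed.

Theorem theorem5 (R : realType) (n : nat) (hn : (0 < n)%N) :
  is_maximum_cardinality (@pairwise_odd_distances R n) (2 ^ n)%N.
Proof.
have -> : (2 ^ n)%N = #|{ffun 'I_n -> bool}| by rewrite card_ffun card_bool card_ord.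
split.
  pose vertex (b : {ffun 'I_n -> bool}) : 'rV[R]_n := \row_i (b i)%:R.
  exists (range vertex); split.
    move=> _ _ [b _ <-] [c _ <-] neq_vertex.
    exists 0; rewrite mulr0 add0r; apply: dist_cube_vertices.
    by apply/eqP => bc; apply: neq_vertex; rewrite bc.
  apply: card_eq_trans (card_eq_finT _); apply: inj_card_eq => b c _ _ eq_vertex.
  (* Injectivity of [vertex]: different [b] and [c] would put one and the same point at distance [1]
     from itself. *)
  apply/eqP/negPn/negP => /(dist_cube_vertices R _ _ _) /eqP.
  by rewrite -/(vertex b) -/(vertex c) eq_vertex subrr normr0 eq_sym oner_eq0.
move=> A oddA; rewrite -(card_le_eqr (card_eq_finT _)).
pose parity (x : 'rV[R]_n) := [ffun i => (2 %| Num.floor (x ord0 i))%Z].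
have inj_parity : {in A &, injective parity}.
  move=> x y /set_mem Ax /set_mem Ay eq_parity; apply: contrapT => neqxy.
  move: (parity_separates _ _ _ _ (oddA x y Ax Ay neqxy)).
  by rewrite -!/(parity _) eq_parity eqxx.
(* [A] may be infinite a priori; it is replaced by its equinumerous image under [parity], a subset
   of a finite type. *)
by rewrite -(card_le_eql (inj_card_eq inj_parity)); exact: card_leT.
Qed.
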